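(* Let $n\ge 2$ be an integer and let $L$ be a Lie color algebra over a commutative ring $R$. If $\frac{1}{n-1}\in R$ (i.e. $n-1$ is invertible in $R$), $L$ is perfect and $L$ has zero center, then: (1) $nDer(L)=Der(L)$; (2) $nDer(Der(L))=ad(Der(L))$.
   Context: Let $R$ be a commutative ring with identity and $\Gamma$ an (additive) abelian group. A bicharacter on $\Gamma$ is a map $\epsilon:\Gamma\times\Gamma\to R\setminus\{0\}$ with $\epsilon(\alpha,\beta)\epsilon(\beta,\alpha)=1$, $\epsilon(\alpha,\beta+\gamma)=\epsilon(\alpha,\beta)\epsilon(\alpha,\gamma)$, $\epsilon(\alpha+\beta,\gamma)=\epsilon(\alpha,\gamma)\epsilon(\beta,\gamma)$ for all $\alpha,\beta,\gamma\in\Gamma$. For homogeneous elements $x,y$ of $\Gamma$-graded $R$-modules (or homogeneous endomorphisms), $\epsilon(x,y)$ means $\epsilon(|x|,|y|)$, where $|\cdot|$ is the degree; similarly $\epsilon(D,\sum_k x_k)$ means $\epsilon(|D|,\sum_k|x_k|)$. A Lie color algebra $(L,[\cdot,\cdot],\epsilon)$ over $R$ is a $\Gamma$-graded $R$-module $L=\bigoplus_{\alpha\in\Gamma}L_\alpha$ with a bicharacter $\epsilon$ on $\Gamma$ and an $R$-bilinear map $[\cdot,\cdot]:L\times L\to L$ such that $[L_\alpha,L_\beta]\subseteq L_{\alpha+\beta}$ and, for all homogeneous $x,y,z$, $[x,y]=-\epsilon(x,y)[y,x]$ and $\epsilon(z,x)[x,[y,z]]+\epsilon(x,y)[y,[z,x]]+\epsilon(y,z)[z,[x,y]]=0$.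 $L$ is perfect if $[L,L]=L$, where $[L,L]$ is the $R$-span of all brackets. The center is $Z(L)=\{x\in L:[x,y]=0\ \forall y\in L\}$. For $n\ge2$, a (homogeneous) $n$-derivation of $L$ of degree $|D|\in\Gamma$ is an $R$-module endomorphism $D$ of $L$ with $D(L_\alpha)\subseteq L_{\alpha+|D|}$ for all $\alpha$, such that for all homogeneous $x_1,\dots,x_n\in L$, $$D([[\cdots[[x_1,x_2],x_3],\cdots, x_{n-1}],x_n])=[[\cdots[[D(x_1),x_2],x_3],\cdots, x_{n-1}],x_n]+\sum_{i=2}^{n}\epsilon\Big(D,\sum_{k=1}^{i-1}x_k\Big)[[\cdots[\cdots[[x_1,x_2],x_3],\cdots, D(x_i)],\cdots, x_{n-1}],x_n].$$ $nDer(L)$ is the $R$-submodule of the $R$-module endomorphisms of $L$ spanned by all $n$-derivations. $Der(L)$, the derivation algebra of $L$, is the case $n=2$. With the bracket $[D_1,D_2]=D_1D_2-\epsilon(D_1,D_2)D_2D_1$ for homogeneous $D_1,D_2$ (extended bilinearly), $Der(L)$ is a Lie color algebra, and $nDer(Der(L))$ denotes the span of the $n$-derivations of this Lie color algebra. For a Lie color algebra $M$ and $x\in M$, $ad\,x:M\to M$ is $y\mapsto[x,y]$, and $ad(M)=\{ad\,x:x\in M\}$; thus $ad(Der(L))$ is the set of inner derivations of $Der(L)$. *)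

(* Defs.v *)
From HB Require Import structures.
From mathcomp Require Import all_boot all_algebra ssrAC.
From mathcomp Require Import boolp classical_sets functions.

Set Implicit Arguments.
Unset Strict Implicit.
Unset Printing Implicit Defensive.

Import GRing.Theory.
Local Open Scope classical_set_scope.
Local Open Scope ring_scope.

Record bicharacter (R : comPzRingType) (Gamma : zmodType)
    (e : Gamma -> Gamma -> R) : Prop := Bicharacter {
  bichar_neq0 : forall a b, e a b <> 0;
  bicharC : forall a b, e a b * e b a = 1;
  bicharDr : forall a b c, e a (b + c) = e a b * e a c;
  bicharDl : forall a b c, e (a + b) c = e a c * e b c
}.

(* [M] is the internal direct sum of the submodules [M_ a]. *)
Record grading (R : comPzRingType) (Gamma : zmodType) (M : lmodType R)
    (M_ : Gamma -> set M) : Prop := Grading {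
  grading0 : forall a, M_ a 0;
  gradingP : forall a (k : R) x y, M_ a x -> M_ a y -> M_ a (k *: x + y);
  grading_span : forall x : M, exists (s : seq Gamma) (f : Gamma -> M),
    [/\ uniq s, forall a, M_ a (f a) & x = \sum_(a <- s) f a];
  grading_free : forall (s : seq Gamma) (f : Gamma -> M),
    uniq s -> (forall a, M_ a (f a)) -> \sum_(a <- s) f a = 0 ->
    forall a, a \in s -> f a = 0
}.

(* Identities between homogeneous elements are required for every choice of *)
(* degrees of these elements; only 0 has more than one degree, and there the *)
(* identities hold trivially.                                               *)
Record lieColorAlgebra (R : comPzRingType) (Gamma : zmodType) :=
    LieColorAlgebra {
  carrier :> lmodType R;
  eps : Gamma -> Gamma -> R;
  homog : Gamma -> set carrier;
  bracket : carrier -> carrier -> carrier;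
  epsP : bicharacter eps;
  homogP : grading homog;
  bracket_linearl : forall y, linear (bracket^~ y);
  bracket_linearr : forall x, linear (bracket x);
  bracket_homog : forall a b x y,
    homog a x -> homog b y -> homog (a + b) (bracket x y);
  bracket_skew : forall a b x y, homog a x -> homog b y ->
    bracket x y = - (eps a b *: bracket y x);
  bracket_jacobi : forall a b c x y z,
    homog a x -> homog b y -> homog c z ->
    eps c a *: bracket x (bracket y z) + eps a b *: bracket y (bracket z x)
      + eps b c *: bracket z (bracket x y) = 0
}.

Section Span.
Variables (R : comPzRingType) (V : lmodType R).

Definition rspan (S : set V) : set V :=
  [set x | exists s : seq (R * V),
     (forall p, p \in s -> S p.2) /\ x = \sum_(p <- s) p.1 *: p.2].

Lemma rspan0 S : rspan S 0.
Proof. by exists [::]; split=> //; rewrite big_nil. Qed.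

Lemma rspan_linear S (k : R) x y :
  rspan S x -> rspan S y -> rspan S (k *: x + y).
Proof.
move=> [s [hs ->]] [t [ht ->]].
exists ([seq (k * p.1, p.2) | p <- s] ++ t); split.
  move=> p; rewrite mem_cat => /orP[/mapP[q qs ->]/=|/ht//]; exact: hs.
rewrite big_cat big_map scaler_sumr; congr (_ + _).
by apply: eq_bigr => p _; rewrite scalerA.
Qed.

Lemma rspan_incl (S : set V) x : S x -> rspan S x.
Proof.
move=> Sx; exists [:: (1, x)]; split; last by rewrite big_seq1 scale1r.
by move=> p; rewrite inE => /eqP->.
Qed.

End Span.

Section Notions.
Variables (R : comPzRingType) (Gamma : zmodType).
Implicit Type L : lieColorAlgebra R Gamma.

Definition perfect L : Prop :=
  rspan [set z : L | exists x y : L, z = bracket x y] = [set: L].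

Definition center L : set L := [set x | forall y : L, bracket x y = 0].

Definition ad L (x : L) : L -> L := bracket x.

(* [lnbracket x m] is [[..[x 0, x 1], ..], x m], of m.+1 arguments. *)
Fixpoint lnbracket L (x : nat -> L) (m : nat) : L :=
  if m is m'.+1 then bracket (lnbracket x m') (x m) else x 0%N.

Definition subst_at L (x : nat -> L) (i : nat) (y : L) : nat -> L :=
  fun j => if j == i then y else x j.

(* Arguments are numbered from 0; only [x i] and [d i] with [i < n] matter. *)
Record homog_nder (n : nat) L (g : Gamma) (D : L -> L) : Prop := HomogNDer {
  nder_linear : linear D;
  nder_homog : forall a x, homog a x -> homog (a + g) (D x);
  nder_leibniz : forall (x : nat -> L) (d : nat -> Gamma),
    (forall i, (i < n)%N -> homog (d i) (x i)) ->
    D (lnbracket x n.-1) =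
      lnbracket (subst_at x 0 (D (x 0%N))) n.-1
      + \sum_(1 <= i < n) eps L g (\sum_(0 <= k < i) d k)
                          *: lnbracket (subst_at x i (D (x i))) n.-1
}.

Definition nDer (n : nat) L : set (L -> L) :=
  rspan [set D : L -> L | exists g, homog_nder n g D].

Arguments nDer n L _ : clear implicits.

Definition Der L : set (L -> L) := nDer 2 L.

Arguments Der L _ : clear implicits.

End Notions.

Arguments perfect {R Gamma} L.
Arguments center {R Gamma} L _.
Arguments nDer {R Gamma} n L _.
Arguments Der {R Gamma} L _.
Arguments ad {R Gamma} L x _.

Section Components.
Variables (R : comPzRingType) (Gamma : zmodType) (M : lmodType R).
Variables (M_ : Gamma -> set M) (gM : grading M_).

Lemma decomp_ex (x : M) : exists p : seq Gamma * (Gamma -> M),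
  [/\ uniq p.1, forall a, M_ a (p.2 a) & x = \sum_(a <- p.1) p.2 a].
Proof. by case: (grading_span gM x) => s [f h]; exists (s, f). Qed.

Definition decomp x := projT1 (cid (decomp_ex x)).
Definition degrees x : seq Gamma := (decomp x).1.
Definition component (a : Gamma) x : M :=
  if a \in degrees x then (decomp x).2 a else 0.

Lemma degrees_uniq x : uniq (degrees x).
Proof. by rewrite /degrees /decomp; case: cid => p []. Qed.

Lemma component_homog a x : M_ a (component a x).
Proof.
rewrite /component /degrees /decomp; case: cid => p [_ h _] /=.
by case: ifP => _; [exact: h|exact: grading0].
Qed.

Lemma component_notin a x : a \notin degrees x -> component a x = 0.
Proof. by rewrite /component => /negPf->. Qed.

Lemma sum_restrict (s t : seq Gamma) (V : zmodType) (f : Gamma -> V) :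
  uniq s -> uniq t -> {subset s <= t} -> (forall a, a \notin s -> f a = 0) ->
  \sum_(a <- t) f a = \sum_(a <- s) f a.
Proof.
move=> us ut st f0.
rewrite (bigID [in s]) /= [X in _ + X]big1 ?addr0; last by move=> a /f0.
rewrite -big_filter; apply: perm_big; apply: uniq_perm => //.
  exact: filter_uniq.
by move=> a; rewrite mem_filter; case: (boolP (a \in s)) => //= /st.
Qed.

Lemma component_sum x s : uniq s -> {subset degrees x <= s} ->
  x = \sum_(a <- s) component a x.
Proof.
move=> us hs; rewrite (sum_restrict (degrees_uniq x) us hs); last first.
  by move=> a; exact: component_notin.
rewrite /component /degrees /decomp; case: cid => p [_ _ hx] /=.
by rewrite {1}hx; apply: eq_big_seq => a ->.
Qed.

Lemma gradingB a x y : M_ a x -> M_ a y -> M_ a (x - y).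
Proof. by move=> hx hy; rewrite addrC -scaleN1r; exact: gradingP. Qed.

Lemma component_unique s (f : Gamma -> M) x : uniq s ->
  (forall a, M_ a (f a)) -> (forall a, a \notin s -> f a = 0) ->
  x = \sum_(a <- s) f a -> forall a, component a x = f a.
Proof.
move=> us hf f0 hx a.
pose t := undup (a :: s ++ degrees x).
have ut : uniq t by exact: undup_uniq.
have at_ : a \in t by rewrite mem_undup inE eqxx.
have st : {subset s <= t}.
  by move=> b bs; rewrite mem_undup inE mem_cat bs orbT.
have dt : {subset degrees x <= t}.
  by move=> b bs; rewrite mem_undup inE mem_cat bs !orbT.
apply/eqP; rewrite -subr_eq0; apply/eqP.
apply: (grading_free gM (f := fun b => component b x - f b) ut) at_.
  by move=> b; apply: gradingB => //; exact: component_homog.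
by rewrite sumrB -(component_sum ut dt) (sum_restrict us ut st f0) -hx subrr.
Qed.

Lemma component_linear a : linear (component a).
Proof.
move=> k x y; pose t := undup (degrees x ++ degrees y).
apply: (@component_unique t
  (fun b => k *: component b x + component b y)).
- exact: undup_uniq.
- by move=> b; apply: gradingP => //; exact: component_homog.
- move=> b; rewrite mem_undup mem_cat negb_or => /andP[h1 h2].
  by rewrite !component_notin // scaler0 addr0.
- rewrite big_split -scaler_sumr; congr (_ *: _ + _).
    apply: component_sum; first exact: undup_uniq.
    by move=> b; rewrite mem_undup mem_cat => ->.
  apply: component_sum; first exact: undup_uniq.
  by move=> b; rewrite mem_undup mem_cat => ->; rewrite orbT.
Qed.

Lemma component_hom a x b : M_ a x -> component b x = if b == a then x else 0.
Proof.
move=> hx; move: b.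
apply: (@component_unique [:: a]) => //.
- by move=> b; case: eqP => [->//|_]; exact: grading0.
- by move=> b; rewrite inE => /negPf->.
- by rewrite big_seq1 eqxx.
Qed.

Variables (N : lmodType R) (h : Gamma -> Gamma -> M -> M -> N).

(* The bilinear map which is [h a b] on [M_ a] x [M_ b]. *)
Definition bilin_ext (x y : M) : N :=
  \sum_(a <- degrees x) \sum_(b <- degrees y) h a b (component a x)
                                                    (component b y).

Hypothesis hl : forall a b y, M_ b y ->
  forall k x1 x2, M_ a x1 -> M_ a x2 ->
  h a b (k *: x1 + x2) y = k *: h a b x1 y + h a b x2 y.
Hypothesis hr : forall a b x, M_ a x ->
  forall k y1 y2, M_ b y1 -> M_ b y2 ->
  h a b x (k *: y1 + y2) = k *: h a b x y1 + h a b x y2.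

Lemma h0l a b y : M_ b y -> h a b 0 y = 0.
Proof.
move=> hy; have h0 := grading0 gM a.
have := hl hy 1 h0 h0; rewrite scaler0 addr0 scale1r => e0.
by apply: (addrI (h a b 0 y)); rewrite addr0 -e0.
Qed.

Lemma h0r a b x : M_ a x -> h a b x 0 = 0.
Proof.
move=> hx; have h0 := grading0 gM b.
have := hr hx 1 h0 h0; rewrite scaler0 addr0 scale1r => e0.
by apply: (addrI (h a b x 0)); rewrite addr0 -e0.
Qed.

Lemma bilin_extE s t x y : uniq s -> uniq t ->
  {subset degrees x <= s} -> {subset degrees y <= t} ->
  bilin_ext x y =
  \sum_(a <- s) \sum_(b <- t) h a b (component a x) (component b y).
Proof.
move=> us ut hs ht; rewrite /bilin_ext.
rewrite (sum_restrict (degrees_uniq x) us hs); last first.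
  move=> a an; rewrite big1// => b _; rewrite component_notin// h0l//.
  exact: component_homog.
apply: eq_bigr => a _; rewrite (sum_restrict (degrees_uniq y) ut ht)//.
by move=> b bn; rewrite (component_notin bn) h0r//; exact: component_homog.
Qed.

Lemma bilin_ext_linearl y : linear (bilin_ext^~ y).
Proof.
move=> k x1 x2 /=.
pose s := undup (degrees x1 ++ degrees x2 ++ degrees (k *: x1 + x2)).
have us : uniq s by exact: undup_uniq.
have uy := degrees_uniq y.
rewrite !(@bilin_extE s (degrees y))//.
- rewrite scaler_sumr -big_split; apply: eq_bigr => a _ /=.
  rewrite scaler_sumr -big_split; apply: eq_bigr => b _ /=.
  by rewrite component_linear hl//; exact: component_homog.
- by move=> b; rewrite mem_undup !mem_cat => ->; rewrite ?orbT.
- by move=> b; rewrite mem_undup !mem_cat => ->; rewrite ?orbT.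
- by move=> b; rewrite mem_undup !mem_cat => ->; rewrite ?orbT.
Qed.

Lemma bilin_ext_linearr x : linear (bilin_ext x).
Proof.
move=> k y1 y2 /=.
pose s := undup (degrees y1 ++ degrees y2 ++ degrees (k *: y1 + y2)).
have us : uniq s by exact: undup_uniq.
have ux := degrees_uniq x.
rewrite !(@bilin_extE (degrees x) s)//.
- rewrite scaler_sumr -big_split; apply: eq_bigr => a _ /=.
  rewrite scaler_sumr -big_split; apply: eq_bigr => b _ /=.
  by rewrite component_linear hr//; exact: component_homog.
- by move=> b; rewrite mem_undup !mem_cat => ->; rewrite ?orbT.
- by move=> b; rewrite mem_undup !mem_cat => ->; rewrite ?orbT.
- by move=> b; rewrite mem_undup !mem_cat => ->; rewrite ?orbT.
Qed.

Lemma bilin_ext_hom a b x y : M_ a x -> M_ b y -> bilin_ext x y = h a b x y.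
Proof.
move=> hx hy.
pose s := undup (a :: degrees x); pose t := undup (b :: degrees y).
rewrite (@bilin_extE s t) ?undup_uniq//; first last.
- by move=> c; rewrite mem_undup inE => ->; rewrite orbT.
- by move=> c; rewrite mem_undup inE => ->; rewrite orbT.
rewrite (bigD1_seq a) ?undup_uniq ?mem_undup ?inE ?eqxx//= [X in _ + X]big1 ?addr0.
  rewrite (bigD1_seq b) ?undup_uniq ?mem_undup ?inE ?eqxx//= [X in _ + X]big1 ?addr0.
    by rewrite (component_hom a hx) (component_hom b hy) !eqxx.
  move=> c /negPf cb; rewrite (component_hom c hy) cb h0r//.
  exact: component_homog.
move=> c /negPf ca; rewrite big1// => d _.
by rewrite (component_hom c hx) ca h0l//; exact: component_homog.
Qed.

End Components.

Section DerAlgebra.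
Variables (R : comPzRingType) (Gamma : zmodType) (L : lieColorAlgebra R Gamma).

Definition der_pred : {pred L -> L} := [pred D | `[< Der L D >]].

Lemma der_predP D : reflect (Der L D) (D \in der_pred).
Proof. by rewrite inE; exact: asboolP. Qed.

Fact der_pred_submod : submod_closed der_pred.
Proof.
split; first by apply/der_predP; exact: rspan0.
by move=> k x y /der_predP hx /der_predP hy; apply/der_predP/rspan_linear.
Qed.

HB.instance Definition _ :=
  GRing.isSubmodClosed.Build R (L -> L) der_pred der_pred_submod.

Record der_type := DerType { der_fun : L -> L; _ : der_fun \in der_pred }.

HB.instance Definition _ := [isSub for der_fun].
HB.instance Definition _ := [Choice of der_type by <:].
HB.instance Definition _ := [SubChoice_isSubLmodule of der_type by <:].

Definition der_homog (a : Gamma) : set der_type :=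
  [set D | homog_nder 2 a (der_fun D)].


Let comp_lin (D E : L -> L) : linear D -> linear E -> linear (D \o E).
Proof. by move=> hD hE k x y /=; rewrite hE hD. Qed.

Let lin0 (D : L -> L) : linear D -> D 0 = 0.
Proof.
move=> hD; have := hD 1 0 0; rewrite scaler0 addr0 scale1r => e0.
by apply: (addrI (D 0)); rewrite addr0 -e0.
Qed.

Let linD (D : L -> L) : linear D -> {morph D : x y / x + y}.
Proof. by move=> hD x y; have := hD 1 x y; rewrite !scale1r. Qed.

Let linZ (D : L -> L) : linear D -> forall k, {morph D : x / k *: x}.
Proof. by move=> hD k x; have := hD k x 0; rewrite !addr0 lin0// addr0. Qed.

Let linN (D : L -> L) : linear D -> {morph D : x / - x}.
Proof. by move=> hD x; rewrite -scaleN1r linZ// scaleN1r. Qed.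

Let faddE (D E : L -> L) x : (D + E) x = D x + E x. Proof. by []. Qed.
Let foppE (D : L -> L) x : (- D) x = - D x. Proof. by []. Qed.
Let fscaleE k (D : L -> L) x : (k *: D) x = k *: D x. Proof. by []. Qed.
Let fzeroE x : (0 : L -> L) x = 0. Proof. by []. Qed.
Let fE := (faddE, foppE, fscaleE, fzeroE).

Lemma homog_der2P g (D : L -> L) : homog_nder 2 g D <->
  [/\ linear D, forall a x, homog a x -> homog (a + g) (D x) &
    forall a b x y, homog a x -> homog b y ->
      D (bracket x y) = bracket (D x) y + eps L g a *: bracket x (D y)].
Proof.
split=> [[hl hh h]|[hl hh h]]; split=> //.
  move=> a b x y hx hy.
  have := h (fun i => if i is 0 then x else y) (fun i => if i is 0 then a else b).
  rewrite big_nat1 /= big_nat1; apply.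
  by case=> [|[|]].
move=> x d hx; rewrite big_nat1 /= big_nat1.
by apply: h; exact: hx.
Qed.

Definition color_comm (a b : Gamma) (D E : L -> L) : L -> L :=
  D \o E - eps L a b *: (E \o D).

Lemma homog_der_submod g k (D E : L -> L) :
  homog_nder 2 g D -> homog_nder 2 g E -> homog_nder 2 g (k *: D + E).
Proof.
move=> /homog_der2P[lD hD DP] /homog_der2P[lE hE EP]; apply/homog_der2P; split.
- move=> c x y; rewrite !fE lD lE !scalerDr !scalerA [k * c]mulrC.
  by rewrite addrACA.
- move=> a x hx; rewrite !fE; apply: (gradingP (homogP L)); last exact: hE.
  exact: hD.
- move=> a b x y hx hy; rewrite !fE (DP _ _ _ _ hx hy) (EP _ _ _ _ hx hy).
  rewrite bracket_linearr (bracket_linearl y k) !scalerDr !scalerA.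
  by rewrite [k * _]mulrC addrACA.
Qed.

Lemma homog_der0 g : homog_nder 2 g (0 : L -> L).
Proof.
apply/homog_der2P; split.
- by move=> c x y; rewrite !fE scaler0 addr0.
- by move=> a x _; exact: (grading0 (homogP L)).
- move=> a b x y _ _; rewrite !fE.
  have -> : bracket (0 : L) y = 0 by exact: (lin0 (@bracket_linearl _ _ L y)).
  by rewrite (lin0 (@bracket_linearr _ _ L x)) scaler0 addr0.
Qed.

Lemma color_comm_der a b D E : homog_nder 2 a D -> homog_nder 2 b E ->
  homog_nder 2 (a + b) (color_comm a b D E).
Proof.
have [_ eC eDr eDl] := epsP L.
move=> /homog_der2P[lD hD DP] /homog_der2P[lE hE EP]; apply/homog_der2P; split.
- move=> c x y; rewrite /color_comm !fE (comp_lin lD lE) (comp_lin lE lD).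
  rewrite !scalerDr !scalerA [_ * c]mulrC !scalerN !scalerA opprD addrACA.
  by [].
- move=> c x hx; apply: gradingB; first exact: (homogP L).
    by rewrite [a + b]addrC addrA; apply: hD; apply: hE.
  rewrite -[X in homog _ X]addr0; apply: (gradingP (homogP L)).
    by rewrite addrA; apply: hE; apply: hD.
  exact: (grading0 (homogP L)).
- move=> c d x y hx hy; rewrite /color_comm !fE /=.
  rewrite (EP _ _ _ _ hx hy) (DP _ _ _ _ hx hy).
  rewrite (linD lD) (linD lE) (linZ lD) (linZ lE).
  rewrite (DP _ _ _ _ (hE _ _ hx) hy) (DP _ _ _ _ hx (hE _ _ hy)).
  rewrite (EP _ _ _ _ (hD _ _ hx) hy) (EP _ _ _ _ hx (hD _ _ hy)).
  rewrite (linD (@bracket_linearl _ _ L y)) (linN (@bracket_linearl _ _ L y)).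
  rewrite (linZ (@bracket_linearl _ _ L y)).
  rewrite (linD (@bracket_linearr _ _ L x)) (linN (@bracket_linearr _ _ L x)).
  rewrite (linZ (@bracket_linearr _ _ L x)).
  rewrite !scalerDr !scalerN !scalerA !eDr eDl ?scalerDr ?scalerN ?scalerA.
  have -> : eps L a b * (eps L b c * eps L b a) = eps L b c.
    by rewrite mulrCA eC mulr1.
  set p := bracket (D (E x)) y; set q := bracket (E x) (D y).
  set r := bracket (D x) (E y); set s := bracket x (D (E y)).
  set t := bracket (E (D x)) y; set u := bracket x (E (D y)).
  rewrite [eps L a c * eps L a b]mulrC [eps L b c * eps L a c]mulrC.
  rewrite [eps L a c * eps L b c * eps L a b]mulrC !mulrA.
  set A := _ *: q; set B := _ *: r; set C := _ *: s.
  set T := _ *: t; set U := _ *: u.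
  rewrite !opprD; have -> : p + A + (B + C) = p + C + (A + B).
    by rewrite (AC (2*2) ((1*4)*(2*3))).
  have -> : - T - B + (- A - U) = (- T - U) + (- (A + B)).
    by rewrite opprD (AC (2*2) ((1*4)*(3*2))).
  by rewrite addrACA subrr addr0 (AC (2*2) ((1*3)*(2*4))).
Qed.
Lemma der_funP (D : der_type) : Der L (der_fun D).
Proof. by case: D => D /= /der_predP. Qed.

Lemma der_fun_inj (D E : der_type) : der_fun D = der_fun E -> D = E.
Proof. exact: val_inj. Qed.

Lemma der_fun_linear : linear (der_fun : der_type -> (L -> L)).
Proof. by move=> k x y; rewrite -[der_fun]/val linearP. Qed.

Lemma der_funD (D E : der_type) : der_fun (D + E) = der_fun D + der_fun E.
Proof. by []. Qed.

Lemma der_funN (D : der_type) : der_fun (- D) = - der_fun D.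
Proof. by []. Qed.

Lemma der_funZ k (D : der_type) : der_fun (k *: D) = k *: der_fun D.
Proof. by []. Qed.

Lemma der_fun_sum I (s : seq I) (F : I -> der_type) :
  der_fun (\sum_(i <- s) F i) = \sum_(i <- s) der_fun (F i).
Proof. exact: (raddf_sum (val : der_type -> (L -> L))). Qed.

Lemma sum_fE I (s : seq I) (F : I -> L -> L) x :
  (\sum_(i <- s) F i) x = \sum_(i <- s) F i x.
Proof. by elim/big_rec2: _ => // i y1 y2 _ <-. Qed.

Lemma Der_sum I (s : seq I) (F : I -> L -> L) :
  (forall i, Der L (F i)) -> Der L (\sum_(i <- s) F i).
Proof.
move=> h; elim/big_ind: _ => //; first exact: rspan0.
by move=> x y hx hy; rewrite -[x]scale1r; apply: rspan_linear.
Qed.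

Lemma homog_Der g D : homog_nder 2 g D -> Der L D.
Proof. by move=> h; apply: rspan_incl; exists g. Qed.

Definition der_of g D (h : homog_nder 2 g D) : der_type :=
  DerType (introT (der_predP D) (homog_Der h)).

Lemma der_grading : grading der_homog.
Proof.
split.
- by move=> a; exact: homog_der0.
- move=> a k x y hx hy.
  change (homog_nder 2 a (der_fun (k *: x + y))); rewrite der_fun_linear.
  exact: homog_der_submod.
- move=> D; have [s [hs hD]] := der_funP D.
  have /choice[g gP] : forall p : R * (L -> L), exists g,
      p \in s -> homog_nder 2 g p.2.
    move=> p; have [/hs[g hg]|_] := boolP (p \in s); first by exists g.
    by exists 0.
  pose F a : L -> L := \sum_(p <- s | g p == a) p.1 *: p.2.
  have hF a : homog_nder 2 a (F a).
    rewrite /F big_seq_cond; elim/big_ind: _ => [|x y hx hy|p].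
    + exact: homog_der0.
    + by rewrite -[x]scale1r; exact: homog_der_submod.
    + move=> /andP[/gP hp /eqP <-]; rewrite -[X in homog_nder _ _ X]addr0.
      by apply: homog_der_submod => //; exact: homog_der0.
  exists (undup (map g s)), (fun a => der_of (hF a)); split.
  + exact: undup_uniq.
  + by move=> a; exact: hF.
  + apply: der_fun_inj; rewrite hD der_fun_sum /= /F (exchange_big_dep xpredT)//=.
    apply: eq_big_seq => p ps; rewrite big_mkcond /= (bigD1_seq (g p)) //=.
    + rewrite eqxx big1 ?addr0// => a /negPf ga.
      by rewrite eq_sym ga.
    + by rewrite mem_undup map_f.
    + exact: undup_uniq.
- move=> s f us hf f0 a as_; apply: der_fun_inj; apply/funext => x.
  have [t [u [ut hu ->]]] := grading_span (homogP L) x.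
  have lfa : linear (der_fun (f a)) by case: (hf a).
  transitivity (\sum_(c <- t) der_fun (f a) (u c)).
    elim: (t) => [|c t' IH]; first by rewrite !big_nil lin0.
    by rewrite !big_cons linD// IH.
  apply: big1 => c _; rewrite -[RHS]/(0 : L).
  pose v d := der_fun (f (d - c)) (u c).
  have -> : der_fun (f a) (u c) = v (c + a) by rewrite /v [c + a]addrC addrK.
  apply: (grading_free (homogP L) (s := [seq c + b | b <- s])).
  + by rewrite map_inj_uniq//; exact: addrI.
  + move=> d; rewrite /v -[X in homog X](subrKC c).
    by case: (hf (d - c)) => _ + _; apply; exact: hu.
  + rewrite big_map; under eq_bigr do rewrite /v [c + _]addrC addrK.
    rewrite -(sum_fE s (fun i => der_fun (f i)) (u c)) -der_fun_sum.
    by rewrite f0.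
  + by rewrite map_f.
Qed.

Definition der_comm (a b : Gamma) (D E : der_type) : L -> L :=
  color_comm a b (der_fun D) (der_fun E).

Let der_comml a b y : der_homog b y -> forall k x1 x2,
  der_homog a x1 -> der_homog a x2 ->
  der_comm a b (k *: x1 + x2) y = k *: der_comm a b x1 y + der_comm a b x2 y.
Proof.
move=> /homog_der2P[ly _ _] k x1 x2 _ _.
rewrite /der_comm /color_comm der_fun_linear; apply/funext => z.
rewrite !fE /= !fE ly !scalerDr !scalerN !scalerA [_ * k]mulrC.
by rewrite opprD addrACA.
Qed.

Let der_commr a b x : der_homog a x -> forall k y1 y2,
  der_homog b y1 -> der_homog b y2 ->
  der_comm a b x (k *: y1 + y2) = k *: der_comm a b x y1 + der_comm a b x y2.
Proof.
move=> /homog_der2P[lx _ _] k y1 y2 _ _.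
rewrite /der_comm /color_comm der_fun_linear; apply/funext => z.
rewrite !fE /= !fE lx !scalerDr !scalerN !scalerA [_ * k]mulrC.
by rewrite opprD addrACA.
Qed.

Definition der_bracket_fun (D E : der_type) : L -> L :=
  bilin_ext der_grading der_comm D E.

Lemma der_bracket_in D E : der_bracket_fun D E \in der_pred.
Proof.
apply/der_predP/Der_sum => a; apply: Der_sum => b.
apply: (@homog_Der (a + b)); apply: color_comm_der.
  exact: (component_homog der_grading a D).
exact: (component_homog der_grading b E).
Qed.

(* [D, E] = D E - eps(a, b) E D for D, E of degrees a, b, extended           *)
(* bilinearly; see [der_bracket_homE].                                      *)
Definition der_bracket (D E : der_type) : der_type :=
  DerType (der_bracket_in D E).

Lemma der_bracket_homE a b D E : der_homog a D -> der_homog b E ->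
  der_fun (der_bracket D E) =
  der_fun D \o der_fun E - eps L a b *: (der_fun E \o der_fun D).
Proof. by move=> hD hE; apply: bilin_ext_hom. Qed.

Lemma der_bracket_linearl E : linear (der_bracket^~ E).
Proof.
move=> k x y; apply: der_fun_inj; rewrite der_fun_linear.
by apply: bilin_ext_linearl.
Qed.

Lemma der_bracket_linearr D : linear (der_bracket D).
Proof.
move=> k x y; apply: der_fun_inj; rewrite der_fun_linear.
by apply: bilin_ext_linearr.
Qed.

Lemma der_bracket_homog a b D E : der_homog a D -> der_homog b E ->
  der_homog (a + b) (der_bracket D E).
Proof.
move=> hD hE; change (homog_nder 2 (a + b) (der_fun (der_bracket D E))).
rewrite (der_bracket_homE hD hE); exact: color_comm_der.
Qed.

Lemma der_bracket_skew a b D E : der_homog a D -> der_homog b E ->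
  der_bracket D E = - (eps L a b *: der_bracket E D).
Proof.
move=> hD hE; apply: der_fun_inj; rewrite der_funN der_funZ.
rewrite (der_bracket_homE hD hE) (der_bracket_homE hE hD).
by rewrite scalerBr scalerA (bicharC (epsP L)) scale1r opprB.
Qed.

Let cyclic_cancel (V : zmodType) (p q r s t u : V) :
  p - q + s - r + r - u + q - t + t - s + u - p = 0.
Proof.
rewrite !subrK (addrAC _ (- u)) (addrAC _ s) subrK.
by rewrite (addrAC _ (- u)) addrK subrK subrr.
Qed.

Let jacobi_expand a b c D E F :
  der_homog a D -> der_homog b E -> der_homog c F ->
  der_fun (eps L c a *: der_bracket D (der_bracket E F)) =
  eps L c a *: (der_fun D \o der_fun E \o der_fun F)
  - (eps L c a * eps L b c) *: (der_fun D \o der_fun F \o der_fun E)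
  - (eps L a b *: (der_fun E \o der_fun F \o der_fun D)
     - (eps L a b * eps L b c) *: (der_fun F \o der_fun E \o der_fun D)).
Proof.
have [_ eC eDr _] := epsP L.
move=> hD hE hF; have hEF := der_bracket_homog hE hF.
rewrite der_funZ (der_bracket_homE hD hEF) (der_bracket_homE hE hF).
have /homog_der2P[lD _ _] := hD; apply/funext => z; rewrite !fE /= !fE.
rewrite (linD lD) (linN lD) (linZ lD).
rewrite !scalerBr !scalerA eDr.
have -> : eps L c a * (eps L a b * eps L a c) = eps L a b.
  by rewrite mulrCA eC mulr1.
by [].
Qed.

Lemma der_bracket_jacobi a b c D E F :
  der_homog a D -> der_homog b E -> der_homog c F ->
  eps L c a *: der_bracket D (der_bracket E F)
  + eps L a b *: der_bracket E (der_bracket F D)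
  + eps L b c *: der_bracket F (der_bracket D E) = 0.
Proof.
move=> hD hE hF; apply: der_fun_inj.
rewrite !der_funD.
rewrite (jacobi_expand hD hE hF) (jacobi_expand hE hF hD).
rewrite (jacobi_expand hF hD hE).
rewrite [eps L a b * eps L c a]mulrC [eps L b c * eps L a b]mulrC.
rewrite [eps L b c * eps L c a]mulrC.
move: (eps L c a *: _) (_ *: (_ \o der_fun F \o der_fun E)) => p q.
move: (eps L a b *: _) ((eps L a b * _) *: _) => r s.
move: (eps L b c *: _) ((eps L c a * _) *: _) => t u.
by rewrite !opprB !addrA; exact: cyclic_cancel.
Qed.

Definition DerAlg : lieColorAlgebra R Gamma :=
  LieColorAlgebra (epsP L) der_grading der_bracket_linearl der_bracket_linearr
    der_bracket_homog der_bracket_skew der_bracket_jacobi.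

End DerAlgebra.

(* Main.v *)
Require Import Defs.
From mathcomp Require Import all_boot all_algebra ssrAC.
From mathcomp Require Import boolp classical_sets functions.

(** A linear map D of degree g is compared with a derivation through the
    bilinear map Delta(x, y) = D[x, y] - [D x, y] - [tw x, D y] ([defect]).
    Here tw ([twist]) multiplies the component of degree a by eps(g, a): with
    it the signs of the Leibniz rule need no degrees.

    Every derivation is an n-derivation ([der_nder]). Conversely let D be an
    n-derivation with n >= 3. For a left-nested bracket w = [x1, x2, s] of
    length n - 1, the element [w, [a, b]] is an n-fold bracket of x1, x2, s
    and [a, b]; by the Jacobi identity it is also a combination of the n-fold
    brackets of [x1, x2], s, a, b and of [x1, x2], s, b, a. Comparing the two
    values of D on it yields ([bracket_defect])

      [tw w, Delta(a, b)] = [[Delta(x1, x2), s], [a, b]].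

    The brackets w span L and the center is zero, so Delta(a, b) depends only
    on [a, b] and Delta(a, b) = phi[a, b] for a linear phi
    ([defect_factor]). The identity then shows that phi moves across a bracket,
    [phi u, x] = [tw u, phi x] ([bracket_phi]), and finally that
    phi[u, x] = [phi u, x] ([phi_bracket]): phi is in the centroid. The
    Leibniz sum of a bracket w of length n therefore differs from D w by
    (n - 1) phi(w) ([leibniz_defect]). This difference is zero, n - 1 is
    invertible and L is spanned by the w, so phi = 0 and D is a derivation
    ([nder_der]).

    For the second assertion, L embeds by ad ([inner]) as an ideal of
    M = Der L, with [E, ad x] = ad(E x). An n-derivation F of M maps ad L to
    itself, because each ad x is a sum of n-fold brackets in the ideal ad L.
    It induces on L an n-derivation, hence a derivation d, and F agrees with
    ad d on ad L ([nder_inner_der]). For E in M and w in ad L, the bracket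
    [w, E] is in ad L; evaluating F and ad d on it shows that F E - [d, E]
    is centralized by ad L. Such an element of M is zero, so F = ad d
    ([nder_ad]). Conversely ad d is a derivation of M by the Jacobi identity
    ([ad_der]), hence an n-derivation. *)

Import GRing.Theory.
Local Open Scope classical_set_scope.
Local Open Scope ring_scope.

(** * Brackets and gradings *)

Section ColorAlgebra.
Set Implicit Arguments.
Unset Strict Implicit.
Unset Printing Implicit Defensive.
Variables (R : comPzRingType) (Gamma : zmodType) (L : lieColorAlgebra R Gamma).
Implicit Types (x y z u v w : L) (s : seq L) (a b c g : Gamma).

Lemma bracketPl k x y z :
  bracket (k *: x + y) z = k *: bracket x z + bracket y z.
Proof. exact: (@bracket_linearl _ _ L z k x y). Qed.

Lemma bracketPr k x y z :
  bracket z (k *: x + y) = k *: bracket z x + bracket z y.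
Proof. exact: (@bracket_linearr _ _ L z k x y). Qed.

Lemma lin0 (V W : lmodType R) (D : V -> W) : linear D -> D 0 = 0.
Proof. by move=> lD; have := lD (-1) 0 0; rewrite !scaleN1r !addNr. Qed.

Lemma linD (V W : lmodType R) (D : V -> W) (x y : V) :
  linear D -> D (x + y) = D x + D y.
Proof. by move=> lD; have := lD 1 x y; rewrite !scale1r. Qed.

Lemma linZ (V W : lmodType R) (D : V -> W) k (x : V) :
  linear D -> D (k *: x) = k *: D x.
Proof. by move=> lD; have := lD k x 0; rewrite (lin0 lD) !addr0. Qed.

Lemma linB (V W : lmodType R) (D : V -> W) (x y : V) :
  linear D -> D (x - y) = D x - D y.
Proof. by move=> lD; rewrite (linD _ _ lD) -scaleN1r (linZ _ _ lD) scaleN1r. Qed.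

Lemma bracket0l x : bracket 0 x = 0.
Proof. exact: (lin0 (@bracket_linearl _ _ L x)). Qed.

Lemma bracket0r x : bracket x 0 = 0.
Proof. exact: (lin0 (@bracket_linearr _ _ L x)). Qed.

Lemma bracketDl x y z : bracket (x + y) z = bracket x z + bracket y z.
Proof. exact: (linD _ _ (@bracket_linearl _ _ L z)). Qed.

Lemma bracketDr x y z : bracket z (x + y) = bracket z x + bracket z y.
Proof. exact: (linD _ _ (@bracket_linearr _ _ L z)). Qed.

Lemma bracketBl x y z : bracket (x - y) z = bracket x z - bracket y z.
Proof. exact: (linB _ _ (@bracket_linearl _ _ L z)). Qed.

Lemma bracketBr x y z : bracket z (x - y) = bracket z x - bracket z y.
Proof. exact: (linB _ _ (@bracket_linearr _ _ L z)). Qed.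

Lemma bracketZl k x z : bracket (k *: x) z = k *: bracket x z.
Proof. exact: (linZ _ _ (@bracket_linearl _ _ L z)). Qed.

Lemma bracketZr k x z : bracket z (k *: x) = k *: bracket z x.
Proof. exact: (linZ _ _ (@bracket_linearr _ _ L z)). Qed.

Lemma bracketNl x z : bracket (- x) z = - bracket x z.
Proof. by rewrite -scaleN1r bracketZl scaleN1r. Qed.

Definition is_homog x : Prop := exists a, homog a x.

(** Predicates that hold on a submodule; identities between linear maps, and
    closure statements, are extended from generators through them. *)
Definition submodule_pred (P : L -> Prop) : Prop :=
  P 0 /\ forall k x y, P x -> P y -> P (k *: x + y).

Lemma submodule_pred_eq (f h : L -> L) : linear f -> linear h ->
  submodule_pred (fun x => f x = h x).
Proof.
move=> lf lh; split; first by rewrite (lin0 lf) (lin0 lh).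
by move=> k x y fx fy; rewrite lf lh fx fy.
Qed.

Lemma submodule_pred_sum (I : eqType) (r : seq I) (F : I -> L) P :
  submodule_pred P -> (forall i, i \in r -> P (F i)) -> P (\sum_(i <- r) F i).
Proof.
move=> [P0 PP] PF; rewrite big_seq; elim/big_ind: _ => // x y Px Py.
by rewrite -[x]scale1r; exact: PP.
Qed.

Lemma homog_ind P : submodule_pred P -> (forall a x, homog a x -> P x) ->
  forall x, P x.
Proof.
move=> PP Ph x; have [s [f [_ hf ->]]] := grading_span (homogP L) x.
by apply: submodule_pred_sum => // a _; exact: Ph (hf a).
Qed.

Lemma homogZ a k x : homog a x -> homog a (k *: x).
Proof.
move=> hx; rewrite -[_ *: _]addr0; apply: (gradingP (homogP L)) => //.
exact: (grading0 (homogP L)).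
Qed.

Lemma homogB a x y : homog a x -> homog a y -> homog a (x - y).
Proof. exact: (gradingB (homogP L)). Qed.

Lemma is_homog_bracket x y : is_homog x -> is_homog y -> is_homog (bracket x y).
Proof. by move=> [a ha] [b hb]; exists (a + b); exact: bracket_homog. Qed.

(** The Jacobi identity says that right multiplications represent the color
    bracket. In this form the sign depends on the degrees of x and y only, so
    w ranges over all of L. *)
Lemma jacobi_right a b w x y : homog a x -> homog b y ->
  bracket w (bracket x y) =
  bracket (bracket w x) y - eps L a b *: bracket (bracket w y) x.
Proof.
have [_ eC eDr eDl] := epsP L.
move=> hx hy; move: w; apply: homog_ind; first split.
- by rewrite !bracket0l scaler0 subr0.
- move=> k v w Pv Pw; rewrite !bracketPl Pv Pw.
  rewrite !scalerDr !scalerN !scalerA [_ * k]mulrC opprD.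
  by rewrite addrACA.
move=> c w hw.
have := bracket_jacobi hw hx hy.
rewrite (bracket_skew hx (bracket_homog hy hw)).
rewrite (bracket_skew hy (bracket_homog hw hx)) (bracket_skew hy hw).
rewrite bracketNl bracketZl !eDr !scalerN opprK !scalerA.
rewrite (mulrCA (eps L c a)) eC mulr1 (mulrCA (eps L a b)) eC mulr1.
move=> /(congr1 (fun v => eps L c b *: 0 + eps L c b *: v)).
rewrite !scaler0 !add0r scalerDr scalerDr scalerN !scalerA.
rewrite [eps L a b * _]mulrC mulrA !eC mul1r !scale1r.
by move=> /eqP; rewrite subr_eq0 => /eqP <-; rewrite addrK.
Qed.

(** Multiplication by a homogeneous element shifts degrees, hence permutes
    the components. *)
Lemma component_bracketr e c z y : homog e z ->
  component (homogP L) (e + c) (bracket z y) =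
  bracket z (component (homogP L) c y).
Proof.
move=> hz; move: y; apply: homog_ind.
  apply: submodule_pred_eq => k x y.
    by rewrite bracketPr component_linear.
  by rewrite component_linear bracketPr.
move=> b y hy; rewrite (component_hom _ _ hy).
rewrite (component_hom _ _ (bracket_homog hz hy)) (inj_eq (addrI e)).
by case: eqP => // _; rewrite bracket0r.
Qed.

Lemma component_bracketl e c z y : homog e z ->
  component (homogP L) (c + e) (bracket y z) =
  bracket (component (homogP L) c y) z.
Proof.
move=> hz; move: y; apply: homog_ind.
  apply: submodule_pred_eq => k x y.
    by rewrite bracketPl component_linear.
  by rewrite component_linear bracketPl.
move=> b y hy; rewrite (component_hom _ _ hy).
rewrite (component_hom _ _ (bracket_homog hy hz)) (inj_eq (addIr e)).
by case: eqP => // _; rewrite bracket0l.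
Qed.

Lemma component_eq0 x : (forall c, component (homogP L) c x = 0) -> x = 0.
Proof.
move=> x0.
have -> := component_sum (degrees_uniq (homogP L) x) (fun _ => id).
by rewrite big1.
Qed.

Section Twist.
Variable g : Gamma.

(** The sign picked up when an operator of degree g moves past x. *)
Definition twist x : L :=
  \sum_(a <- degrees (homogP L) x) eps L g a *: component (homogP L) a x.

Lemma twistE (r : seq Gamma) x : uniq r -> {subset degrees (homogP L) x <= r} ->
  twist x = \sum_(a <- r) eps L g a *: component (homogP L) a x.
Proof.
move=> ur sub; rewrite /twist.
rewrite (sum_restrict (degrees_uniq (homogP L) x) ur sub) //.
by move=> a an; rewrite component_notin // scaler0.
Qed.

Lemma twist_homog a x : homog a x -> twist x = eps L g a *: x.
Proof.
move=> hx; rewrite (@twistE (undup (a :: degrees (homogP L) x)));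
  [|exact: undup_uniq|by move=> b; rewrite mem_undup inE => ->; rewrite orbT].
rewrite (bigD1_seq a) ?undup_uniq ?mem_undup ?inE ?eqxx //= big1 ?addr0.
  by rewrite (component_hom _ _ hx) eqxx.
by move=> b /negPf ba; rewrite (component_hom _ _ hx) ba scaler0.
Qed.

Lemma twist_linear : linear twist.
Proof.
move=> k x y; pose r := undup (degrees (homogP L) x ++ degrees (homogP L) y
  ++ degrees (homogP L) (k *: x + y)).
have ur : uniq r by exact: undup_uniq.
rewrite !(@twistE r) // ?scaler_sumr -?big_split /=; first last.
- by move=> b; rewrite mem_undup !mem_cat => ->; rewrite ?orbT.
- by move=> b; rewrite mem_undup !mem_cat => ->; rewrite ?orbT.
- by move=> b; rewrite mem_undup !mem_cat => ->; rewrite ?orbT.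
by apply: eq_bigr => a _; rewrite component_linear scalerDr !scalerA mulrC.
Qed.

Lemma twist_bracket x y : is_homog x -> is_homog y ->
  twist (bracket x y) = bracket (twist x) (twist y).
Proof.
move=> [a ha] [b hb]; rewrite (twist_homog ha) (twist_homog hb).
rewrite (twist_homog (bracket_homog ha hb)) bracketZl bracketZr scalerA.
by rewrite (bicharDr (epsP L)).
Qed.

(** The twist is onto, since bicharacters take invertible values. *)
Lemma twist_eps a x : homog a x -> x = twist (eps L a g *: x).
Proof.
move=> hx; rewrite (twist_homog (homogZ _ hx)) scalerA.
by rewrite (bicharC (epsP L)) scale1r.
Qed.

End Twist.

(** * Left-nested brackets and the Leibniz sum *)

Definition all_homog s : Prop := forall x, x \in s -> is_homog x.

Lemma all_homog_cons x s : all_homog (x :: s) <-> is_homog x /\ all_homog s.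
Proof.
split=> [h|[hx hs] y]; last by rewrite inE => /orP[/eqP ->|/hs].
by split=> [|y ys]; apply: h; rewrite inE ?eqxx ?ys ?orbT.
Qed.

Lemma all_homog_rcons x s : all_homog (rcons s x) <-> is_homog x /\ all_homog s.
Proof.
rewrite -all_homog_cons; split=> h y ys; apply: h.
  by rewrite mem_rcons.
by rewrite -mem_rcons.
Qed.

Definition lbracket u s : L := foldl (@bracket _ _ L) u s.

Lemma lbracket_rcons u s x : lbracket u (rcons s x) = bracket (lbracket u s) x.
Proof. exact: foldl_rcons. Qed.

Lemma lbracket_linear s : linear (lbracket^~ s).
Proof.
elim: s => [|z s IH] k x y //; rewrite /lbracket /= bracketPl; exact: IH.
Qed.

Lemma lbracket_is_homog u s :
  is_homog u -> all_homog s -> is_homog (lbracket u s).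
Proof.
elim: s u => [|x s IH] u hu //= /all_homog_cons[hx hs].
by apply: IH => //; exact: is_homog_bracket.
Qed.

Section Leibniz.
Variables (g : Gamma) (D : L -> L).

(** The Leibniz sum of the bracket of u, x1, ..., xm, computed from the left:
    v stands for the image of u under D, and each step applies the product
    rule to one more bracket. Leaving v free lets two ways of reading the same
    bracket be compared. *)
Fixpoint leibniz u v s : L :=
  if s is x :: s' then
    leibniz (bracket u x) (bracket v x + bracket (twist g u) (D x)) s'
  else v.

Lemma leibniz_cons u v x s : leibniz u v (x :: s) =
  leibniz (bracket u x) (bracket v x + bracket (twist g u) (D x)) s.
Proof. by []. Qed.

Lemma leibniz_rcons u v s x : leibniz u v (rcons s x) =
  bracket (leibniz u v s) x + bracket (twist g (lbracket u s)) (D x).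
Proof. by elim: s u v => //= y s IH u v; rewrite IH. Qed.

Lemma leibnizD u v w s : leibniz u (v + w) s = leibniz u v s + lbracket w s.
Proof.
elim: s u v w => //= x s IH u v w; rewrite -IH bracketDl; congr leibniz.
by rewrite addrAC.
Qed.

Lemma map_iota_rcons (T : Type) (x : nat -> T) m :
  map x (iota 1 m.+1) = rcons (map x (iota 1 m)) (x m.+1).
Proof. by rewrite -[m.+1 in LHS]addn1 iotaD map_cat cats1 add1n. Qed.

Lemma lnbracket_lbracket (x : nat -> L) m :
  lnbracket x m = lbracket (x 0%N) (map x (iota 1 m)).
Proof. by elim: m => // m IH; rewrite map_iota_rcons lbracket_rcons -IH. Qed.

Lemma eq_lnbracket (x y : nat -> L) m :
  (forall i, (i <= m)%N -> x i = y i) -> lnbracket x m = lnbracket y m.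
Proof.
elim: m => [|m IH] xy /=; first exact: xy.
by rewrite IH ?xy // => i im; rewrite xy // leqW.
Qed.

Lemma lnbracket_homog (x : nat -> L) (d : nat -> Gamma) m :
  (forall i, (i < m.+1)%N -> homog (d i) (x i)) ->
  homog (\sum_(0 <= k < m.+1) d k) (lnbracket x m).
Proof.
elim: m => [|m IH] hx; first by rewrite big_nat1; exact: hx.
rewrite big_nat_recr //=; apply: bracket_homog; last exact: hx.
by apply: IH => i im; apply: hx; exact: leqW.
Qed.

(** The recursion agrees with the sum over positions: the last summand is the
    one where D hits the last entry, and its sign is the twist of everything
    before it. *)
Lemma leibniz_lnbracket m (x : nat -> L) (d : nat -> Gamma) :
  (forall i, (i < m.+1)%N -> homog (d i) (x i)) ->
  lnbracket (subst_at x 0 (D (x 0%N))) m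
  + \sum_(1 <= i < m.+1) eps L g (\sum_(0 <= k < i) d k)
                          *: lnbracket (subst_at x i (D (x i))) m
  = leibniz (x 0%N) (D (x 0%N)) (map x (iota 1 m)).
Proof.
elim: m => [|m IH] hx; first by rewrite big_geq //= addr0.
rewrite big_nat_recr // map_iota_rcons /= leibniz_rcons -IH; last first.
  by move=> i im; apply: hx; exact: leqW.
rewrite -lnbracket_lbracket.
have hm : homog (\sum_(0 <= k < m.+1) d k) (lnbracket x m).
  by apply: lnbracket_homog => i im; apply: hx; exact: leqW.
rewrite (twist_homog _ hm) bracketZl bracketDl addrA; congr (_ + _ + _ *: _).
- rewrite (big_morph (fun v => bracket v (x m.+1))
    (fun u v => bracketDl u v (x m.+1)) (bracket0l _)).
  apply: eq_big_nat => i /andP[_ im]; rewrite bracketZl {2}/subst_at.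
  by rewrite [_ == i]gtn_eqF.
- rewrite {2}/subst_at eqxx; congr bracket; apply: eq_lnbracket => i im.
  by rewrite /subst_at ltn_eqF.
Qed.

(** The definition of an n-derivation without the degrees of the entries: the
    twist recovers the signs from the entries themselves. *)
Lemma homog_nderP n : homog_nder n.+1 g D <->
  [/\ linear D, forall a x, homog a x -> homog (a + g) (D x) &
    forall u s, is_homog u -> all_homog s -> size s = n ->
      D (lbracket u s) = leibniz u (D u) s].
Proof.
split=> [[lD hD DP]|[lD hD DP]]; split=> //.
  move=> u s hu hs ns; pose x i := nth 0 (u :: s) i.
  have hx i : exists d, homog d (x i).
    rewrite /x; have [ils|sli] := ltnP i (size (u :: s)); last first.
      by exists 0; rewrite nth_default //; exact: (grading0 (homogP L)).
    move: (mem_nth 0 ils); move: (nth _ _ _) => y.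
    by rewrite inE => /orP[/eqP ->|/hs].
  have [d hd] := choice hx.
  have xs : map x (iota 1 n) = s.
    by rewrite map_nth_iota ?drop1 /= ?ns ?subn1 // take_oversize // ns.
  have := DP x d (fun i _ => hd i).
  by rewrite /= leibniz_lnbracket // lnbracket_lbracket xs.
move=> x d hx; rewrite /= leibniz_lnbracket // lnbracket_lbracket; apply: DP.
- by exists (d 0%N); exact: hx.
- move=> _ /mapP[i + ->]; rewrite mem_iota add1n => /andP[_ im].
  by exists (d i); exact: hx.
- by rewrite size_map size_iota.
Qed.

Lemma homog_der2E : homog_nder 2 g D ->
  forall x y, is_homog x -> is_homog y ->
  D (bracket x y) = bracket (D x) y + bracket (twist g x) (D y).
Proof.
move=> /(homog_nderP 1)[_ _ DP] x y hx hy; apply: (DP x [:: y]) => //.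
by move=> z; rewrite inE => /eqP ->.
Qed.

Lemma der_nder n : homog_nder 2 g D -> homog_nder n.+1 g D.
Proof.
move=> D2; have DE := homog_der2E D2.
have [lD hD _] := D2; apply/homog_nderP; split=> // u s hu hs _ {n}.
elim/last_ind: s hs => // s x IH /all_homog_rcons[hx hs].
by rewrite leibniz_rcons lbracket_rcons DE ?IH //; exact: lbracket_is_homog.
Qed.

End Leibniz.

Lemma ad_der a x : homog a x -> homog_nder 2 a (ad L x).
Proof.
move=> hx; apply/homog_der2P; split.
- exact: bracket_linearr.
- by move=> b y hy; rewrite addrC; exact: bracket_homog.
- move=> b c y z hy hz; rewrite /ad (jacobi_right x hy hz).
  rewrite (bracket_skew (bracket_homog hx hz) hy) scalerN opprK scalerA.
  have [_ eC _ eDl] := epsP L.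
  by rewrite eDl mulrCA eC mulr1.
Qed.

Lemma ad0 : ad L 0 = 0.
Proof. by apply/funext => z; exact: bracket0l. Qed.

Lemma ad_linear : linear (ad L).
Proof. by move=> k x y; apply/funext => z; exact: bracketPl. Qed.

Lemma submodule_pred_comp (f : L -> L) P : linear f -> submodule_pred P ->
  submodule_pred (fun x => P (f x)).
Proof.
move=> lf [P0 PP]; split=> [|k x y Px Py]; rewrite ?(lin0 lf) ?lf //.
exact: PP.
Qed.

Lemma submodule_pred_bracketl P y :
  submodule_pred P -> submodule_pred (fun x => P (bracket x y)).
Proof.
exact: (@submodule_pred_comp (fun x => bracket x y) _
  (@bracket_linearl _ _ L y)).
Qed.

Lemma submodule_pred_bracketr P x :
  submodule_pred P -> submodule_pred (fun y => P (bracket x y)).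
Proof.
exact: (@submodule_pred_comp (bracket x) _ (@bracket_linearr _ _ L x)).
Qed.

(** * n-derivations of a perfect centerless algebra *)

Section PerfectCenterless.
Hypothesis L_perfect : perfect L.
Hypothesis L_centerless : center L = [set 0].

Lemma perfect_ind P : submodule_pred P ->
  (forall x y, is_homog x -> is_homog y -> P (bracket x y)) -> forall x, P x.
Proof.
move=> PP Ph.
have Pb x y : P (bracket x y).
  move: x; apply: homog_ind; first exact: submodule_pred_bracketl.
  move=> a x hx; move: y; apply: homog_ind.
    exact: submodule_pred_bracketr.
  by move=> b y hy; apply: Ph; [exists a|exists b].
move=> x; have : [set: L] x by [].
rewrite -L_perfect => -[r [hr ->]].
apply: submodule_pred_sum => // p /hr[y [z ->]].
by case: PP => P0 PP; rewrite -[_ *: _]addr0; exact: PP.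
Qed.

(** Perfectness can be iterated: each entry of a bracket is a sum of brackets
    in turn, so brackets of any given length span. *)
Lemma perfect_lbracket_ind m P : submodule_pred P ->
  (forall u s, is_homog u -> all_homog s -> size s = m ->
    P (lbracket u s)) ->
  forall x, P x.
Proof.
elim: m P => [|m IH] P PP Ph.
  by apply: homog_ind => // a x hx; apply: (Ph x [::]) => //; exists a.
apply: perfect_ind => // x y _ hy; move: x; apply: IH.
  exact: submodule_pred_bracketl.
move=> u s hu hs sm; rewrite -lbracket_rcons; apply: Ph => //.
  exact/all_homog_rcons.
by rewrite size_rcons sm.
Qed.

Lemma centerless_l x : (forall y, is_homog y -> bracket x y = 0) -> x = 0.
Proof.
move=> x0; have : center L x.
  apply: homog_ind => [|a y hy]; last by apply: x0; exists a.
  split=> [|k y z y0 z0]; first exact: bracket0r.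
  by rewrite bracketPr y0 z0 scaler0 addr0.
by rewrite L_centerless.
Qed.

(** The center is defined by brackets on one side. Skew-symmetry exchanges
    the sides on homogeneous elements only, hence the passage to
    components. *)
Lemma centerless_r x : (forall y, is_homog y -> bracket y x = 0) -> x = 0.
Proof.
move=> x0; apply: component_eq0 => c; apply: centerless_l => y [e hy].
rewrite (bracket_skew (component_homog (homogP L) c x) hy).
rewrite -(component_bracketr _ _ hy) x0; last by exists e.
rewrite (lin0 (component_linear (homogP L) _)).
by rewrite scaler0 oppr0.
Qed.

Lemma lbracket_eq0 m v :
  (forall s, all_homog s -> size s = m -> lbracket v s = 0) -> v = 0.
Proof.
elim: m v => [|m IH] v h; first by apply: (h [::]).
apply: IH => s hs sm; apply: centerless_l => y hy.
by rewrite -lbracket_rcons h ?size_rcons ?sm //; exact/all_homog_rcons.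
Qed.

(** An n-derivation D with n = m + 3, in the form of [homog_nderP]. *)
Section NDerivation.
Variables (m : nat) (g : Gamma) (D : L -> L).
Hypothesis lD : linear D.
Hypothesis hD : forall a x, homog a x -> homog (a + g) (D x).
Hypothesis DP : forall u s, is_homog u -> all_homog s -> size s = m.+2 ->
  D (lbracket u s) = leibniz g D u (D u) s.

(** D is a derivation exactly when this bilinear map vanishes. *)
Definition defect x y : L :=
  D (bracket x y) - bracket (D x) y - bracket (twist g x) (D y).

Lemma defect_linearl y : linear (defect^~ y).
Proof.
move=> k x x'; rewrite /defect !(bracketPl, lD, twist_linear).
by rewrite !scalerDr !scalerN !opprD !addrA (AC 6 (1*3*5*2*4*6)).
Qed.

Lemma defect_linearr x : linear (defect x).
Proof.
move=> k y y'; rewrite /defect !(bracketPr, lD).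
by rewrite !scalerDr !scalerN !opprD !addrA (AC 6 (1*3*5*2*4*6)).
Qed.

Lemma defect_homog a b x y : homog a x -> homog b y ->
  homog (a + b + g) (defect x y).
Proof.
move=> hx hy; apply: homogB; first apply: homogB.
- exact/hD/bracket_homog.
- by rewrite addrAC; apply: bracket_homog => //; exact: hD.
- rewrite -addrA (twist_homog _ hx) bracketZl; apply: homogZ.
  by apply: bracket_homog => //; exact: hD.
Qed.

(** Right multiplications by x and y satisfy the Jacobi identity, and so do
    the steps of the Leibniz sum. Writing the bracket with [x, y] through
    those with x, y and with y, x, and grouping x1 and x2 into one entry,
    gives back n entries, to which the Leibniz rule for D applies. *)
Lemma nder_bracket_last x1 x2 s x y :
  is_homog x1 -> is_homog x2 -> all_homog s -> is_homog x -> is_homog y ->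
  size s = m ->
  D (bracket (lbracket x1 (x2 :: s)) (bracket x y)) =
  bracket (leibniz g D (bracket x1 x2) (D (bracket x1 x2)) s) (bracket x y)
  + bracket (twist g (lbracket x1 (x2 :: s)))
      (bracket (D x) y + bracket (twist g x) (D y)).
Proof.
move=> h1 h2 hs [a hx] [b hy] sm.
set w := lbracket x1 _; set q := leibniz _ _ _ _ _.
have hw : is_homog w by apply: lbracket_is_homog => //; exact/all_homog_cons.
have step a' b' x' y' : homog a' x' -> homog b' y' ->
    D (bracket (bracket w x') y') =
    bracket (bracket q x') y' + bracket (bracket (twist g w) (D x')) y'
    + bracket (bracket (twist g w) (twist g x')) (D y').
  move=> hx' hy'; have hom_x' : is_homog x' by exists a'.
  have := DP (u := bracket x1 x2) (s := rcons (rcons s x') y').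
  rewrite !lbracket_rcons !leibniz_rcons lbracket_rcons bracketDl => ->.
  - by rewrite -/q -twist_bracket.
  - exact: is_homog_bracket.
  - apply/all_homog_rcons; split; first by exists b'.
    exact/all_homog_rcons.
  - by rewrite !size_rcons sm.
have [_ _ eDr eDl] := epsP L.
rewrite (jacobi_right w hx hy) linB // linZ // (step _ _ _ _ hx hy).
rewrite (step _ _ _ _ hy hx) bracketDr (jacobi_right q hx hy).
rewrite (jacobi_right _ (hD hx) hy) (twist_homog _ hx) (twist_homog _ hy).
rewrite bracketZl (bracketZr _ (bracket x (D y))) (jacobi_right _ hx (hD hy)).
rewrite !(bracketZr, bracketZl) eDl eDr !scalerDr !scalerN !scalerA.
have -> : eps L g a * (eps L a b * eps L a g) = eps L a b.
  by rewrite mulrCA (bicharC (epsP L)) mulr1.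
by rewrite !opprD !addrA (AC 6 (1*4*2*6*3*5)).
Qed.

(** The same element has n entries also without grouping x1 and x2 nor
    splitting [x, y]. The two Leibniz sums start from D[x1, x2] and from the
    product rule for it; what they do not share are the two defects. *)
Lemma bracket_defect x1 x2 s x y : is_homog x1 -> is_homog x2 -> all_homog s ->
  size s = m ->
  bracket (twist g (lbracket x1 (x2 :: s))) (defect x y) =
  bracket (lbracket (defect x1 x2) s) (bracket x y).
Proof.
move=> h1 h2 hs sm; move: y; apply: homog_ind.
  apply: submodule_pred_eq => k y y'; first by rewrite defect_linearr bracketPr.
  by rewrite !bracketPr.
move=> b y hy; move: x; apply: homog_ind.
  apply: submodule_pred_eq => k x x'; first by rewrite defect_linearl bracketPr.
  by rewrite bracketPl bracketPr.
move=> a x hx; have hx' : is_homog x by exists a.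
have hy' : is_homog y by exists b.
have /eqP := nder_bracket_last h1 h2 hs hx' hy' sm.
have := DP (u := x1) (s := x2 :: rcons s (bracket x y)).
rewrite /= !lbracket_rcons !leibniz_rcons => -> //; first last.
- by rewrite /= size_rcons sm.
- apply/all_homog_cons; split=> //; apply/all_homog_rcons; split=> //.
  exact: is_homog_bracket.
have -> : D (bracket x1 x2) =
    bracket (D x1) x2 + bracket (twist g x1) (D x2) + defect x1 x2.
  by rewrite /defect -[_ - _ - _]addrA -opprD [RHS]addrC subrK.
rewrite [in X in _ == X]leibnizD [in X in _ == X]bracketDl -addrA.
rewrite (inj_eq (addrI _)) => /eqP e.
rewrite /defect -[_ - _ - _]addrA -opprD bracketBr.
by rewrite [X in X - _]e addrK.
Qed.

(** The right-hand side of [bracket_defect] depends on x and y through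
    [x, y] only. An element v playing the role of the defect for z is unique,
    because the twisted brackets on the left span L and the center is zero;
    uniqueness makes the choice of v linear in z. *)
Lemma defect_factor :
  exists2 phi : L -> L, linear phi & forall x y, phi (bracket x y) = defect x y.
Proof.
pose factors z v := forall x1 x2 s,
  is_homog x1 -> is_homog x2 -> all_homog s -> size s = m ->
  bracket (twist g (lbracket x1 (x2 :: s))) v =
    bracket (lbracket (defect x1 x2) s) z.
have factors_uniq z v v' : factors z v -> factors z v' -> v = v'.
  move=> zv zv'; apply/eqP; rewrite -subr_eq0; apply/eqP.
  apply: centerless_r => y [a hy]; rewrite (twist_eps g hy).
  move: (eps L a g *: y); apply: (@perfect_lbracket_ind m.+1).
    apply: (submodule_pred_comp (P := fun y => bracket y (v - v') = 0)).
      exact: twist_linear.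
    by apply: submodule_pred_eq => [|k ? ?];
      [exact: bracket_linearl|rewrite scaler0 addr0].
  move=> x1 [//|x2 s] h1 /all_homog_cons[h2 hs] [sm].
  by rewrite bracketBr zv // zv' // subrr.
have factorsP k z z' v v' : factors z v -> factors z' v' ->
    factors (k *: z + z') (k *: v + v').
  move=> zv zv' x1 x2 s h1 h2 hs sm.
  by rewrite !bracketPr zv // zv'.
have /choice[phi phiP] : forall z, exists v, factors z v.
  apply: perfect_ind.
    split; first by exists 0 => x1 x2 s *; rewrite !bracket0r.
    by move=> k z z' [v zv] [v' zv']; exists (k *: v + v'); exact: factorsP.
  by move=> x y _ _; exists (defect x y) => x1 x2 s *; exact: bracket_defect.
exists phi.
  move=> k z z'; apply: factors_uniq (phiP _) _.
  exact: factorsP.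
move=> x y; apply: factors_uniq (phiP _) _ => x1 x2 s *.
exact: bracket_defect.
Qed.

Section Factor.
Variable phi : L -> L.
Hypothesis phi_linear : linear phi.
Hypothesis phiE : forall x y, phi (bracket x y) = defect x y.

(** [bracket_defect], once both defects are written with phi. *)
Lemma bracket_phi_lbracket u s z : all_homog s -> size s = m ->
  bracket (twist g (lbracket u s)) (phi z) = bracket (lbracket (phi u) s) z.
Proof.
move=> hs sm; move: u; apply: perfect_ind.
  apply: submodule_pred_eq => k u v.
    by rewrite lbracket_linear twist_linear bracketPl.
  by rewrite phi_linear lbracket_linear bracketPl.
move=> x1 x2 h1 h2; rewrite phiE.
move: z; apply: perfect_ind.
  apply: submodule_pred_eq => k y z; last by rewrite bracketPr.
  by rewrite phi_linear bracketPr.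
by move=> x y _ _; rewrite phiE; apply: bracket_defect.
Qed.

(** For m = 0 this is [bracket_phi_lbracket]. Otherwise that lemma applies to
    the bracket of u, x, s and to that of x, u, s, which are proportional by
    skew-symmetry; since the center is zero, the remaining entries s can be
    cancelled. *)
Lemma bracket_phi u x : bracket (phi u) x = bracket (twist g u) (phi x).
Proof.
case mE: m => [|m'].
  by rewrite (@bracket_phi_lbracket u [::] x) // mE.
move: u; apply: homog_ind.
  apply: submodule_pred_eq => k u v; first by rewrite phi_linear bracketPl.
  by rewrite twist_linear bracketPl.
move=> a u hu; move: x; apply: perfect_ind.
  apply: submodule_pred_eq => k x y; first by rewrite bracketPr.
  by rewrite phi_linear bracketPr.
move=> x1 x2 [b1 h1] [b2 h2]; have hx := bracket_homog h1 h2.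
have hphi : homog (b1 + b2 + g) (phi (bracket x1 x2)).
  by rewrite phiE; exact: defect_homog.
set b := b1 + b2 in hx hphi; set x := bracket x1 x2 in hx hphi *.
have swap : bracket (phi u) x + eps L a b *: bracket (phi x) u = 0.
  apply: (@lbracket_eq0 m') => s hs sm; apply: centerless_l => z _.
  have hux := bracket_skew hu hx.
  have lbracketD v w : lbracket (v + w) s = lbracket v s + lbracket w s.
    exact: (linD _ _ (lbracket_linear s)).
  have lbracketZ k v : lbracket (k *: v) s = k *: lbracket v s.
    exact: (linZ _ _ (lbracket_linear s)).
  have lbracketN v : lbracket (- v) s = - lbracket v s.
    by rewrite -scaleN1r lbracketZ scaleN1r.
  have e1 : bracket (lbracket (bracket (phi u) x) s) z =
      bracket (twist g (lbracket (bracket u x) s)) (phi z).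
    rewrite (@bracket_phi_lbracket u (x :: s)) //= ?sm ?mE //.
    by apply/all_homog_cons; split=> //; exists b.
  have e2 : bracket (lbracket (bracket (phi x) u) s) z =
      bracket (twist g (lbracket (bracket x u) s)) (phi z).
    rewrite (@bracket_phi_lbracket x (u :: s)) //= ?sm ?mE //.
    by apply/all_homog_cons; split=> //; exists a.
  rewrite lbracketD lbracketZ bracketDl bracketZl e1 e2 hux lbracketN lbracketZ.
  rewrite -scaleN1r !(linZ _ _ (@twist_linear g)) !bracketZl scaleN1r.
  by rewrite addNr.
move/eqP: swap; rewrite addr_eq0 => /eqP ->.
rewrite (bracket_skew hphi hu) (twist_homog _ hu) bracketZl.
rewrite scalerN opprK scalerA.
have [_ eC _ eDl] := epsP L.
by rewrite eDl mulrA eC mul1r.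
Qed.

(** For n = 3, [bracket_phi_lbracket] has no entries s and gives no hold on
    phi[v, y]. The Leibniz rule for three entries does: its two defects,
    phi[[u, x], y] and [phi[u, x], y], must cancel. *)
Lemma phi_bracket_opp v y : m = 0%N -> is_homog y ->
  phi (bracket v y) = - bracket (phi v) y.
Proof.
move=> m0 hy; move: v; apply: perfect_ind.
  split=> [|k v w Pv Pw].
    by rewrite bracket0l (lin0 phi_linear) bracket0l oppr0.
  by rewrite bracketPl !phi_linear Pv Pw bracketPl opprD scalerN.
move=> u x hu hx; rewrite [in LHS]phiE [in RHS]phiE /defect.
have hxy : all_homog [:: x; y] by move=> z; rewrite !inE => /orP[] /eqP ->.
have -> : D (bracket (bracket u x) y) =
    bracket (bracket (D u) x + bracket (twist g u) (D x)) y
    + bracket (twist g (bracket u x)) (D y).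
  by apply: (DP hu hxy); rewrite m0.
rewrite [_ + bracket (twist g (bracket u x)) _ - _]addrAC addrK.
by rewrite -bracketBl -bracketNl -[_ - _ - _ in RHS]addrA -opprD opprB.
Qed.

(** For n = 3 the sign of [phi_bracket_opp] disappears after two brackets. For
    n > 3, [bracket_phi] and [bracket_phi_lbracket] give the same value to the
    brackets of both sides with any z. *)
Lemma phi_lbracket_gt0 : exists k, forall u s, all_homog s -> size s = k.+1 ->
  phi (lbracket u s) = lbracket (phi u) s.
Proof.
case mE: m => [|m'].
  exists 1%N => u [//|x [//|y [|//]]] /all_homog_cons[hx].
  move=> /all_homog_cons[hy _] _.
  rewrite /lbracket /= phi_bracket_opp // phi_bracket_opp //.
  by rewrite bracketNl opprK.
exists m' => u s hs sm; apply/eqP; rewrite -subr_eq0; apply/eqP.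
apply: centerless_l => z _.
by rewrite bracketBl bracket_phi bracket_phi_lbracket ?mE // subrr.
Qed.

(** Descent on the number of entries. By the Jacobi identity, right
    multiplication by a bracket [y1, y2] is a combination of two successive
    right multiplications, and such brackets span L: if phi passes through
    k + 2 multiplications, it passes through k + 1. *)
Lemma phi_bracket u x : phi (bracket u x) = bracket (phi u) x.
Proof.
have [k] := phi_lbracket_gt0; elim: k => [|k IH] phi_lbracket.
  move: x; apply: homog_ind.
    apply: submodule_pred_eq => k x y; last by rewrite bracketPr.
    by rewrite bracketPr phi_linear.
  move=> a x hx; apply: (phi_lbracket u [:: x]) => // y.
  by rewrite inE => /eqP ->; exists a.
apply: IH => w s; case/lastP: s => // s z /all_homog_rcons[_ hs].
rewrite size_rcons => -[sk]; rewrite !lbracket_rcons.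
move: z; apply: perfect_ind.
  apply: submodule_pred_eq => c z z'; last by rewrite bracketPr.
  by rewrite bracketPr phi_linear.
move=> y1 y2 [a hx] [b hy]; rewrite !(jacobi_right _ hx hy) -!lbracket_rcons.
rewrite linB // linZ // !phi_lbracket ?size_rcons ?sk //.
- apply/all_homog_rcons; split; first by exists a.
  by apply/all_homog_rcons; split; first by exists b.
- apply/all_homog_rcons; split; first by exists b.
  by apply/all_homog_rcons; split; first by exists a.
Qed.

(** Each bracket taken adds one defect, and as phi is in the centroid all of
    them are equal to phi of the whole bracket. *)
Lemma leibniz_defect u s : is_homog u -> all_homog s ->
  leibniz g D u (D u) s = D (lbracket u s) - (size s)%:R *: phi (lbracket u s).
Proof.
move=> hu; elim/last_ind: s => [|s x IH]; first by rewrite scale0r subr0.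
move=> /all_homog_rcons[hx hs].
rewrite leibniz_rcons lbracket_rcons size_rcons IH //.
rewrite bracketBl bracketZl -phi_bracket -natr1 scalerDl scale1r.
rewrite [X in _ = _ - (_ + X)]phiE /defect.
rewrite -[_ - _ - _ in RHS]addrA -opprD [- (_ + (_ - _))]opprD opprB !addrA.
by rewrite [RHS](AC 5 ((1*5)*(3*2*4))) /= subrr add0r.
Qed.

Lemma phi_eq0 (c : R) x : m.+2%:R * c = 1 -> phi x = 0.
Proof.
move=> mc; move: x; apply: (@perfect_lbracket_ind m.+2).
  split=> [|k x y Px Py]; first exact: lin0.
  by rewrite phi_linear Px Py scaler0 addr0.
move=> u s hu hs sm; have := leibniz_defect hu hs; rewrite -DP // sm.
move/eqP; rewrite -[X in X == _]addr0 (inj_eq (addrI _)) eq_sym oppr_eq0.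
move=> /eqP /(congr1 (fun v => c *: v)).
by rewrite scaler0 scalerA mulrC mc scale1r.
Qed.

End Factor.
End NDerivation.

Lemma nder_der n g (D : L -> L) (c : R) : n.+1%:R * c = 1 ->
  homog_nder n.+2 g D -> homog_nder 2 g D.
Proof.
case: n => [//|m] mc /homog_nderP[lD hD DP].
have [phi lphi phiE] := defect_factor lD hD DP.
apply/(homog_nderP g D 1); split=> // u [//|x [|//]] hu /all_homog_cons[hx _] _.
have := phiE u x; rewrite (phi_eq0 lD hD DP lphi phiE _ mc) /defect.
by move/esym/eqP; rewrite -addrA -opprD subr_eq0 => /eqP.
Qed.

End PerfectCenterless.
End ColorAlgebra.

(** * Derivations of the derivation algebra *)

Section Adjoint.
Set Implicit Arguments.
Unset Strict Implicit.
Unset Printing Implicit Defensive.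
Variables (R : comPzRingType) (Gamma : zmodType) (L : lieColorAlgebra R Gamma).
Implicit Type (a b c g : Gamma).
Local Notation M := (DerAlg L).

Lemma ad_in (x : L) : ad L x \in der_pred (L := L).
Proof.
apply/der_predP; move: x; apply: (@homog_ind _ _ L (fun x => Der L (ad L x)));
  last first.
  by move=> a x hx; exact: homog_Der (ad_der hx).
split=> [|k x y hx hy]; last by rewrite ad_linear; exact: rspan_linear.
rewrite ad0; exact: rspan0.
Qed.

(** The adjoint map, with values in the derivation algebra. *)
Definition inner (x : L) : M := DerType (ad_in x).

Lemma der_fun_inner x : der_fun (inner x) = bracket x.
Proof. by []. Qed.

Lemma inner_linear : linear inner.
Proof.
by move=> k x y; apply: der_fun_inj; rewrite der_fun_linear; exact: ad_linear.
Qed.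

Lemma inner0 : inner 0 = 0.
Proof. by apply: der_fun_inj; apply/funext => y; exact: bracket0l. Qed.

Lemma innerD x y : inner (x + y) = inner x + inner y.
Proof. exact: linD inner_linear. Qed.

Lemma innerZ k x : inner (k *: x) = k *: inner x.
Proof. exact: linZ inner_linear. Qed.

Lemma inner_homog a x : homog a x -> homog a (inner x).
Proof. exact: ad_der. Qed.

Lemma inner_is_homog x : is_homog x -> is_homog (inner x).
Proof. by move=> [a hx]; exists a; exact: inner_homog. Qed.

Lemma der_fun_linearE k (E F : M) x :
  der_fun (k *: E + F) x = k *: der_fun E x + der_fun F x.
Proof.
have evalE := congr1 (fun f : L -> L => f x) (der_fun_linear k E F).
exact evalE.
Qed.

Lemma all_homog_map_inner s : all_homog s -> all_homog (map inner s).
Proof. by move=> hs _ /mapP[x /hs hx ->]; exact: inner_is_homog. Qed.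

Lemma der_linear (E : M) : linear (der_fun E).
Proof.
move: E; apply: homog_ind => [|a E [] //].
split=> [k x y|k E F lE lF c x y]; last first.
  rewrite !der_fun_linearE lE lF !scalerDr !scalerA [k * c]mulrC.
  by rewrite addrACA.
by rewrite -[LHS]/(0 : L) -[RHS]/(k *: (0 : L) + 0) scaler0 addr0.
Qed.

(** A derivation E satisfies E[x, y] = [E x, y] + (sign)[x, E y], that is,
    its commutator with ad x is ad(E x). *)
Lemma bracket_inner (E : M) x : bracket E (inner x) = inner (der_fun E x).
Proof.
move: E; apply: homog_ind.
  split=> [|k E F hE hF].
    by rewrite bracket0l inner0.
  by rewrite bracketPl hE hF -inner_linear der_fun_linearE.
move=> a E hE; move: x; apply: homog_ind.
  split=> [|k x y hx hy].
    by rewrite (lin0 (der_linear E)) inner0 bracket0r.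
  by rewrite inner_linear bracketPr hx hy der_linear inner_linear.
move=> b x hx; apply: der_fun_inj; apply/funext; apply: homog_ind.
  by apply: submodule_pred_eq; exact: der_linear.
move=> c y hy; rewrite (der_bracket_homE hE (inner_homog hx)).
have /homog_der2P[_ _ EP] := hE.
rewrite -[LHS]/(der_fun E (bracket x y) - eps L a b *: bracket x (der_fun E y)).
by rewrite (EP _ _ _ _ hx hy) addrK.
Qed.

Lemma twist_inner g x : twist g (inner x) = inner (twist g x).
Proof.
move: x; apply: homog_ind.
  split=> [|k x y hx hy].
    by rewrite inner0 !(lin0 (@twist_linear _ _ _ g)) inner0.
  by rewrite inner_linear !twist_linear inner_linear hx hy.
move=> a x hx; rewrite (twist_homog _ hx) (twist_homog _ (inner_homog hx)).
by rewrite innerZ.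
Qed.

Lemma lbracket_inner u s :
  lbracket (inner u) (map inner s) = inner (lbracket u s).
Proof.
elim/last_ind: s => // s x IH.
by rewrite map_rcons !lbracket_rcons IH bracket_inner.
Qed.

Lemma leibniz_inner g (F : M -> M) (d : L -> L) u v s :
  (forall x, F (inner x) = inner (d x)) ->
  leibniz g F (inner u) (inner v) (map inner s) = inner (leibniz g d u v s).
Proof.
move=> Fd; elim: s u v => // x s IH u v; rewrite map_cons !leibniz_cons.
rewrite -IH !bracket_inner Fd twist_inner bracket_inner; congr leibniz.
by rewrite innerD.
Qed.

Lemma inner_ideal x (E : M) : exists y, bracket (inner x) E = inner y.
Proof.
have PP (f : M -> M) : linear f ->
    submodule_pred (fun E => exists y, f E = inner y).
  move=> lf; split; first by exists 0; rewrite (lin0 lf) inner0.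
  move=> k G H [y Gy] [z Hz]; exists (k *: y + z).
  by rewrite lf Gy Hz inner_linear.
move: E; apply: homog_ind; first exact/PP/bracket_linearr.
move=> b E hE; move: x; apply: homog_ind.
  split; first by exists 0; rewrite inner0 bracket0l.
  move=> k x y [x' hx'] [y' hy']; exists (k *: x' + y').
  by rewrite inner_linear bracketPl hx' hy' inner_linear.
move=> a x hx; exists (- eps L a b *: der_fun E x).
rewrite (bracket_skew (inner_homog hx) hE) bracket_inner -scaleNr.
by rewrite innerZ.
Qed.

(** F may be any map here: the Leibniz sum only brackets its values with
    inner derivations. *)
Lemma leibniz_ideal g (F : M -> M) u v s :
  exists y, leibniz g F (inner u) (inner v) (map inner s) = inner y.
Proof.
elim: s u v => [|x s IH] u v; first by exists v.
rewrite map_cons leibniz_cons !bracket_inner twist_inner.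
have [z ->] := inner_ideal (twist g u) (F (inner x)).
by rewrite -innerD; exact: IH.
Qed.

Section Center.
Hypothesis L_perfect : perfect L.
Hypothesis L_centerless : center L = [set 0].

Lemma inner_inj : injective inner.
Proof.
move=> x y xy; apply/eqP; rewrite -subr_eq0; apply/eqP.
apply: (centerless_l L_centerless) => z _.
have := congr1 (fun E : M => der_fun E z) xy; rewrite !der_fun_inner => e.
by rewrite bracketBl e subrr.
Qed.

(** The degree of x can be read off ad x: a component of x in another degree
    would have zero bracket with all homogeneous elements. *)
Lemma inner_homog_inv a x : homog a (inner x) -> homog a x.
Proof.
move=> hx.
have -> : x = component (homogP L) a x; last exact: component_homog.
apply/eqP; rewrite -subr_eq0; apply/eqP.
apply: (centerless_l L_centerless) => z [e hz].
apply: (@component_eq0 _ _ L) => c.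
rewrite bracketBl -(component_bracketl _ _ hz).
have hb : homog (a + e) (bracket x z).
  by case: hx => _ h _; rewrite addrC; apply: h.
rewrite (component_hom _ _ hb) eqxx subrr.
exact: (lin0 (component_linear (homogP L) c)).
Qed.

Variables (n : nat) (g : Gamma) (c : R) (F : M -> M).
Hypothesis nc : n.+1%:R * c = 1.
Hypothesis F_nder : homog_nder n.+2 g F.

(** The first entry of the Leibniz sum is F (inner u), not known to be inner,
    but its bracket with the next entry is; this uses that n >= 2. *)
Lemma nder_inner x : exists y, F (inner x) = inner y.
Proof.
have /homog_nderP[lF hF FP] := F_nder.
move: x; apply: (perfect_lbracket_ind L_perfect (m := n.+1)).
  split=> [|k x y [x' hx'] [y' hy']].
    by exists 0; rewrite inner0 (lin0 lF).
  by exists (k *: x' + y'); rewrite !inner_linear lF hx' hy'.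
move=> u [//|x s] hu hxs sn; rewrite -lbracket_inner FP ?size_map //.
- rewrite map_cons leibniz_cons !bracket_inner twist_inner.
  have [z ->] := inner_ideal (twist g u) (F (inner x)).
  by rewrite -innerD; exact: leibniz_ideal.
- exact: inner_is_homog.
- exact: all_homog_map_inner.
Qed.

(** The map induced by F on L through the embedding is an n-derivation of L,
    hence a derivation. *)
Lemma nder_inner_der : exists2 d : M, homog g d &
  forall x, F (inner x) = bracket d (inner x).
Proof.
have /homog_nderP[lF hF FP] := F_nder.
have [d Fd] := choice nder_inner.
have d_der : homog_nder 2 g d.
  apply: (nder_der L_perfect L_centerless nc); apply/homog_nderP; split.
  - move=> k x y; apply: inner_inj.
    by rewrite inner_linear -!Fd inner_linear lF.
  - move=> a x hx; apply: inner_homog_inv.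
    by rewrite -Fd; apply: hF; exact: inner_homog.
  - move=> u s hu hs sn; apply: inner_inj.
    rewrite -(leibniz_inner _ _ _ _ Fd) -!Fd -lbracket_inner; apply: FP.
    + exact: inner_is_homog.
    + exact: all_homog_map_inner.
    + by rewrite size_map.
exists (der_of d_der : M); first exact: d_der.
by move=> x; rewrite Fd bracket_inner.
Qed.

(** F and ad d agree on inner derivations, so on a bracket of inner
    derivations followed by E their Leibniz sums differ only in the last
    term. *)
Lemma nder_ad : exists d : M, F = ad M d.
Proof.
have [d hd Fd] := nder_inner_der; exists d.
have /homog_nderP[lF hF FP] := F_nder.
have /(der_nder n.+1)/homog_nderP[lA hA AP] := ad_der hd.
apply/funext; apply: homog_ind; first exact: submodule_pred_eq.
move=> e E hE; apply/eqP; rewrite -subr_eq0; apply/eqP.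
(* A derivation killing the spanning set of twisted brackets is zero. *)
set X := _ - _; have hX : homog (e + g) X.
  by apply: homogB; [exact: hF|exact: hA].
have X_twist x : der_fun X (twist g x) = 0.
  move: x; apply: (perfect_lbracket_ind L_perfect (m := n)).
    apply: submodule_pred_eq; last by move=> k x y; rewrite scaler0 addr0.
    by move=> k x y; rewrite twist_linear der_linear.
  move=> u s hu hs sn; apply: inner_inj; rewrite inner0 -bracket_inner.
  have [a ha] := lbracket_is_homog hu hs.
  have hw : homog a (inner (twist g (lbracket u s))).
    by rewrite (twist_homog _ ha); apply/inner_homog/homogZ.
  rewrite (bracket_skew hX hw).
  suff -> : bracket (inner (twist g (lbracket u s))) X = 0.
    by rewrite scaler0 oppr0.
  have hEs : all_homog (rcons (map inner s) E).
    by apply/all_homog_rcons; split; [exists e|exact: all_homog_map_inner].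
  have sE : size (rcons (map inner s) E) = n.+1.
    by rewrite size_rcons size_map sn.
  have Fd' x : F (inner x) = inner (der_fun d x) by rewrite Fd bracket_inner.
  have Ad' x : ad M d (inner x) = inner (der_fun d x) by exact: bracket_inner.
  (* [inner w, E] is inner, so F and ad d agree on it as well. *)
  have := FP _ _ (inner_is_homog hu) hEs sE.
  have := AP _ _ (inner_is_homog hu) hEs sE.
  rewrite !leibniz_rcons !lbracket_rcons lbracket_inner twist_inner.
  have [y ->] := inner_ideal (lbracket u s) E.
  rewrite !Fd' !Ad' (leibniz_inner _ _ _ _ Fd') (leibniz_inner _ _ _ _ Ad').
  by rewrite /X bracketBr => -> /addrI ->; rewrite subrr.
apply: der_fun_inj; apply/funext; apply: homog_ind.
  split=> [|k x y Xx Xy]; first exact: (lin0 (der_linear X)).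
  by rewrite der_linear Xx Xy -[RHS]/(0 : L) scaler0 addr0.
move=> a x hx; rewrite (twist_eps g hx) X_twist; exact: erefl.
Qed.

End Center.

Lemma der_ad (n : nat) (d : M) : nDer n.+1 M (ad M d).
Proof.
move: d; apply: homog_ind => [|a d hd]; last first.
  by apply: rspan_incl; exists a; exact/der_nder/ad_der.
split=> [|k d e hd he]; last by rewrite ad_linear; exact: rspan_linear.
rewrite ad0; exact: rspan0.
Qed.

End Adjoint.

Theorem theorem2p4 (R : comPzRingType) (Gamma : zmodType) (n : nat)
    (L : lieColorAlgebra R Gamma) (hn : (2 <= n)%N)
    (hinv : exists u : R, (n - 1)%N%:R * u = 1)
    (hperfect : perfect L) (hcenter : center L = [set 0]) :
  nDer n L = Der L /\
  nDer n (DerAlg L) = range (ad (DerAlg L)).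
Proof.
case: n hn hinv => [//|[//|n]] _ [c]; rewrite subn1 /= => nc; split.
  rewrite /Der /nDer; congr rspan; apply/seteqP; split=> D [g hD]; exists g.
    exact: (nder_der hperfect hcenter nc hD).
  exact: der_nder.
apply/seteqP; split=> [D [s [hs ->]]|_ [d _ <-]]; last exact: der_ad.
elim: s hs => [|[k E] s IH] hs.
  exists 0 => //; rewrite big_nil; exact (ad0 (DerAlg L)).
have [|d _ dE] := IH; first by move=> p ps; apply: hs; rewrite inE ps orbT.
have [g hE] := hs (k, E) (mem_head _ _).
have [e eE] : exists e : DerAlg L, E = ad (DerAlg L) e.
  exact (nder_ad hperfect hcenter nc hE).
exists (k *: e + d) => //; rewrite big_cons -dE eE.
exact (ad_linear k e d).
Qed.
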